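(* Let $p$ be a prime, $\Gamma$ a free group of finite rank, $\bullet\in\{S,Z\}$ and $k\ge1$. Then there is an exact sequence of groups $$0\to\mathrm{Hom}(\mathcal N_1^\bullet,\mathcal L_{k+1}^\bullet)\xrightarrow{\ i\ }\mathrm{Aut}(\mathcal N_{k+1}^\bullet)\xrightarrow{\ \psi_k^\bullet\ }\mathrm{Aut}(\mathcal N_k^\bullet)\to1,$$ where $i(f)=(\gamma\mapsto f([\gamma])\gamma)$ and $[\gamma]$ is the class of $\gamma$ in $\mathcal N_1^\bullet$.
   Context: For a group $G$ with lower central series $G_1=G$, $G_k=[G,G_{k-1}]$ and a prime $p$: the Stallings mod-$p$ central series is $G_1^S=G$, $G_k^S=[G,G_{k-1}^S](G_{k-1}^S)^p$; the Zassenhaus mod-$p$ central series is $G_k^Z=\prod_{ip^j\ge k}(G_i)^{p^j}$. Here $H^m$ denotes the subgroup generated by $m$-th powers. For $\bullet\in\{S,Z\}$ set $\mathcal N_k^\bullet=\Gamma/\Gamma_{k+1}^\bullet$ and $\mathcal L_k^\bullet=\Gamma_k^\bullet/\Gamma_{k+1}^\bullet$. Since $\mathcal L_{k+1}^\bullet$ is a characteristic subgroup of $\mathcal N_{k+1}^\bullet$ with quotient $\mathcal N_k^\bullet$, there is an induced homomorphism $\psi_k^\bullet:\mathrm{Aut}(\mathcal N_{k+1}^\bullet)\to\mathrm{Aut}(\mathcal N_k^\bullet)$. *)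

(* Defs.v *)
From HB Require Import structures.
From mathcomp Require Import all_boot.
From mathcomp Require Import boolp classical_sets.
Set Implicit Arguments.
Unset Strict Implicit.
Unset Printing Implicit Defensive.

Local Open Scope classical_set_scope.
Local Open Scope quotient_scope.
Local Open Scope group_scope.

Lemma multiplicative_ext (G H : magmaType) (f g : {multiplicative G -> H}) :
  (forall x, f x = g x) -> f = g.
Proof.
case: f g => f [[fM]] [g [[gM]]] /= /funext fg.
by case: _ / fg gM => gM; rewrite (Prop_irrelevance fM gM).
Qed.

Section GroupMorphisms.
Variables (G H : groupType) (f : {multiplicative G -> H}).

Lemma mor1 : f 1 = 1.
Proof. by apply: (@mulgI _ (f 1)); rewrite -gmulfM !mulg1. Qed.

Lemma morV x : f x^-1 = (f x)^-1.
Proof. by apply: (@mulgI _ (f x)); rewrite -gmulfM !mulgV mor1. Qed.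

Lemma morJ x y : f (x ^ y) = f x ^ f y.
Proof. by rewrite !conjgE !gmulfM morV. Qed.

Lemma morR x y : f [~ x, y] = [~ f x, f y].
Proof. by rewrite !commgEl gmulfM morV morJ. Qed.

Lemma morX x n : f (x ^+ n) = f x ^+ n.
Proof. by elim: n => [|n IHn]; rewrite ?mor1 // !expgS gmulfM IHn. Qed.

End GroupMorphisms.

Definition free_basis (F : groupType) (n : nat) (x : 'I_n -> F) : Prop :=
  forall (H : groupType) (y : 'I_n -> H),
    exists! f : {multiplicative F -> H}, forall i, f (x i) = y i.

Definition free_of_finite_rank (F : groupType) : Prop :=
  exists (n : nat) (x : 'I_n -> F), free_basis x.

Section Subgroups.
Variable G : groupType.
Implicit Types A B : set G.

Definition is_subgroup A : Prop :=
  A 1 /\ (forall x y, A x -> A y -> A (x / y)).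

Definition conj_invariant A : Prop := forall x y, A x -> A (x ^ y).

Definition is_normal A : Prop := is_subgroup A /\ conj_invariant A.

Definition generated A : set G := smallest is_subgroup A.

Definition commutator A B : set G :=
  generated [set [~ x, y] | x in A & y in B].

Definition power_subgroup (m : nat) A : set G :=
  generated [set x ^+ m | x in A].

Definition set_mulg A B : set G := [set x * y | x in A & y in B].

(* Indexed from 1; the value at 0 is a harmless convention, here and below. *)
Fixpoint lower_central (k : nat) : set G :=
  if k is (k'.+1 as m).+1 then commutator setT (lower_central m) else setT.

Fixpoint stallings (p k : nat) : set G :=
  if k is (k'.+1 as m).+1 then
    set_mulg (commutator setT (stallings p m))
             (power_subgroup p (stallings p m))
  else setT.

(* The product over the infinitely many pairs (i, j) of normal subgroups is
   the subgroup generated by their union. *)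
Definition zassenhaus (p k : nat) : set G :=
  generated (\bigcup_(ij in [set ij : nat * nat |
                             (1 <= ij.1)%N /\ (k <= ij.1 * p ^ ij.2)%N])
               power_subgroup (p ^ ij.2) (lower_central ij.1)).

End Subgroups.
Arguments lower_central G k : clear implicits.
Arguments stallings G p k : clear implicits.
Arguments zassenhaus G p k : clear implicits.

Variant modp_kind := Stallings | Zassenhaus.

Definition modp_series (b : modp_kind) (p : nat) (G : groupType) (k : nat) :
    set G :=
  match b with
  | Stallings => stallings G p k
  | Zassenhaus => zassenhaus G p k
  end.
Arguments modp_series b p G k : clear implicits.

Section SubgroupTheory.
Variable G : groupType.
Implicit Types A B : set G.

Lemma subgroupV A x : is_subgroup A -> A x -> A x^-1.
Proof. by move=> [A1 AF] Ax; rewrite -[x^-1]mul1g; exact: AF. Qed.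

Lemma subgroupM A x y : is_subgroup A -> A x -> A y -> A (x * y).
Proof.
move=> AG Ax Ay; rewrite -[y]invgK.
by apply: (proj2 AG) => //; apply: subgroupV.
Qed.

Lemma subgroupX A x n : is_subgroup A -> A x -> A (x ^+ n).
Proof.
move=> AG Ax; elim: n => [|n IHn]; first exact: (proj1 AG).
by rewrite expgS; apply: subgroupM.
Qed.

Lemma generated_subgroup A : is_subgroup (generated A).
Proof.
split=> [M [MG _]|x y Ax Ay M [MG AM]]; first exact: (proj1 MG).
by apply: (proj2 MG); [apply: Ax | apply: Ay].
Qed.

Lemma generated_sub A B : is_subgroup B -> A `<=` B -> generated A `<=` B.
Proof. exact: smallest_sub. Qed.

Lemma sub_generated A : A `<=` generated A.
Proof. exact: sub_gen_smallest. Qed.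

Lemma setT_normal : is_normal [set: G].
Proof. by []. Qed.

Lemma preimage_subgroup (H : groupType) (f : {multiplicative G -> H})
    (B : set H) : is_subgroup B -> is_subgroup (f @^-1` B).
Proof.
move=> BG; split=> [|x y]; rewrite /preimage /= ?mor1; first exact: (proj1 BG).
by move=> Bx By; rewrite gmulfM morV; apply: (proj2 BG).
Qed.

Lemma conjg_subgroup A y : is_subgroup A -> is_subgroup [set x | A (x ^ y)].
Proof.
move=> [A1 AF]; split=> [|x z] /=; first by rewrite conj1g.
by rewrite conjMg conjVg; exact: AF.
Qed.

Lemma generated_normal A : conj_invariant A -> is_normal (generated A).
Proof.
move=> AJ; split; first exact: generated_subgroup.
move=> x y; move: x; apply: generated_sub.
  exact/conjg_subgroup/generated_subgroup.
by move=> x /(AJ _ y) /sub_generated.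
Qed.

Lemma commutator_normal A B :
  is_normal A -> is_normal B -> is_normal (commutator A B).
Proof.
move=> [_ AJ] [_ BJ]; apply: generated_normal => _ z [x Ax [y By <-]].
by exists (x ^ z); [exact: AJ|exists (y ^ z); [exact: BJ|rewrite -conjRg]].
Qed.

Lemma power_normal m A : is_normal A -> is_normal (power_subgroup m A).
Proof.
move=> [_ AJ]; apply: generated_normal => _ z [x Ax <-].
by exists (x ^ z); [exact: AJ|rewrite conjXg].
Qed.

Lemma set_mulg_normal A B : is_normal A -> is_normal B ->
  is_normal (set_mulg A B).
Proof.
move=> [AG AJ] [BG BJ]; split; last first.
  move=> _ z [x Ax [y By <-]]; exists (x ^ z); first exact: AJ.
  by exists (y ^ z); [exact: BJ|rewrite conjMg].
split.
  exists 1; first exact: (proj1 AG).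
  by exists 1; [exact: (proj1 BG)|rewrite mulg1].
move=> _ _ [x Ax [y By <-]] [x' Ax' [y' By' <-]].
exists (x / x'); first exact: (proj2 AG).
exists ((y / y') ^ x'^-1); first by apply/BJ/(proj2 BG).
by rewrite conjgE invgK invgM !mulgA mulgVK.
Qed.

Lemma lower_central_normal k : is_normal (lower_central G k).
Proof.
case: k => [//|k]; elim: k => [//|k IHk].
exact: commutator_normal setT_normal IHk.
Qed.

Lemma stallings_normal p k : is_normal (stallings G p k).
Proof.
case: k => [//|k]; elim: k => [//|k IHk]; apply: set_mulg_normal.
  exact: commutator_normal setT_normal IHk.
exact: power_normal.
Qed.

Lemma zassenhaus_normal p k : is_normal (zassenhaus G p k).
Proof.
apply: generated_normal => x z [ij kij xij]; exists ij => //.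
exact: (proj2 (power_normal _ (lower_central_normal _))).
Qed.

Lemma modp_series_normal b p k : is_normal (modp_series b p G k).
Proof. by case: b; [apply: stallings_normal|apply: zassenhaus_normal]. Qed.

Lemma stallings_le1 p k : stallings G p k.+1 `<=` stallings G p k.
Proof.
case: k => [//|k].
have [SG SJ] := stallings_normal p k.+1.
move=> _ [x Hx [y Hy <-]]; apply: subgroupM => //.
  move: x Hx; apply: generated_sub => // _ [u _ [v Sv <-]].
  rewrite commgEr; apply: subgroupM => //.
  by apply: SJ; apply: subgroupV.
by move: y Hy; apply: generated_sub => // _ [u Su <-]; apply: subgroupX.
Qed.

Lemma modp_series_le b p j k : (j <= k)%N ->
  modp_series b p G k `<=` modp_series b p G j.
Proof.
case: b => jk /=.
  rewrite -(subnK jk); elim: (k - j)%N => [//|d IHd].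
  by rewrite addSn; apply: subset_trans IHd; apply: stallings_le1.
apply: generated_sub; first exact: generated_subgroup.
move=> x [ij [i1 kij] xij]; apply: sub_generated; exists ij => //.
by split=> //; apply: leq_trans kij.
Qed.

End SubgroupTheory.

Section SeriesFunctorial.
Variables (G H : groupType) (f : {multiplicative G -> H}).

Lemma generated_mor (A : set G) (B : set H) :
  f @` A `<=` B -> f @` generated A `<=` generated B.
Proof.
move=> AB; suff sub : generated A `<=` f @^-1` generated B.
  by move=> _ [x /sub fx <-].
apply: generated_sub; first exact/preimage_subgroup/generated_subgroup.
by move=> x Ax; apply: sub_generated; apply: AB; exists x.
Qed.

Lemma commutator_mor (A A' : set G) (B B' : set H) :
  f @` A `<=` B -> f @` A' `<=` B' ->
  f @` commutator A A' `<=` commutator B B'.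
Proof.
move=> AB AB'; apply: generated_mor => _ [_ [x Ax [y Ay <-]] <-].
by exists (f x); [apply: AB; exists x|exists (f y);
  [apply: AB'; exists y|rewrite morR]].
Qed.

Lemma power_mor m (A : set G) (B : set H) :
  f @` A `<=` B -> f @` power_subgroup m A `<=` power_subgroup m B.
Proof.
move=> AB; apply: generated_mor => _ [_ [x Ax <-] <-].
by exists (f x); [apply: AB; exists x|rewrite morX].
Qed.

Lemma lower_central_mor k : f @` lower_central G k `<=` lower_central H k.
Proof. by case: k => [//|k]; elim: k => [//|k IHk]; exact: commutator_mor. Qed.

Lemma modp_series_mor b p k : f @` modp_series b p G k `<=` modp_series b p H k.
Proof.
case: b => /=.
  case: k => [//|k]; elim: k => [//|k IHk] _ [_ [x Hx [y Hy <-]] <-].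
  exists (f x).
    by apply: (@commutator_mor setT _ setT _ _ IHk) => //; exists x.
  exists (f y); last by rewrite gmulfM.
  by apply: (power_mor IHk); exists y.
apply: generated_mor => _ [x [ij kij xij] <-]; exists ij => //.
by apply: (power_mor (@lower_central_mor ij.1)); exists x.
Qed.

Section Surjective.
Hypothesis fS : forall y, exists x, f x = y.

Lemma image_subgroup (A : set G) : is_subgroup A -> is_subgroup (f @` A).
Proof.
move=> [A1 AF]; split; first by exists 1; rewrite ?mor1.
move=> _ _ [x Ax <-] [y Ay <-]; exists (x / y); first exact: AF.
by rewrite gmulfM morV.
Qed.

Lemma generated_surj (A : set G) (B : set H) :
  B `<=` f @` A -> generated B `<=` f @` generated A.
Proof.
move=> BA; apply: generated_sub.
  exact/image_subgroup/generated_subgroup.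
by move=> _ /BA [x Ax <-]; exists x => //; apply: sub_generated.
Qed.

Lemma commutator_surj (A A' : set G) (B B' : set H) :
  B `<=` f @` A -> B' `<=` f @` A' ->
  commutator B B' `<=` f @` commutator A A'.
Proof.
move=> BA BA'; apply: generated_surj.
move=> _ [_ /BA[x Ax <-] [_ /BA'[y Ay <-] <-]].
by exists [~ x, y]; rewrite ?morR //; exists x => //; exists y.
Qed.

Lemma power_surj m (A : set G) (B : set H) :
  B `<=` f @` A -> power_subgroup m B `<=` f @` power_subgroup m A.
Proof.
move=> BA; apply: generated_surj => _ [_ /BA[x Ax <-] <-].
by exists (x ^+ m); rewrite ?morX //; exists x.
Qed.

Lemma setT_surj : [set: H] `<=` f @` [set: G].
Proof. by move=> y _; have [x <-] := fS y; exists x. Qed.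

Lemma lower_central_surj k : lower_central H k `<=` f @` lower_central G k.
Proof.
case: k => [|k]; first exact: setT_surj.
elim: k => [|k IHk]; first exact: setT_surj.
exact: commutator_surj setT_surj IHk.
Qed.

Lemma modp_series_surj b p k :
  modp_series b p H k `<=` f @` modp_series b p G k.
Proof.
case: b => /=.
  case: k => [|k]; first exact: setT_surj.
  elim: k => [|k IHk]; first exact: setT_surj.
  move=> _ [_ /(commutator_surj setT_surj IHk) [x Hx <-]
           [_ /(power_surj IHk) [y Hy <-] <-]].
  by exists (x * y); rewrite ?gmulfM //; exists x => //; exists y.
apply: generated_surj => y [ij kij /(power_surj (@lower_central_surj _))].
by case=> x xij <-; exists x => //; exists ij.
Qed.

End Surjective.
End SeriesFunctorial.

Record normal_subgroup (G : groupType) := NormalSubgroup {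
  nsg_set :> set G;
  nsg_normal : is_normal nsg_set
}.

Section Quotient.
Variables (G : groupType) (H : normal_subgroup G).

Definition coset_rel : rel G := fun x y => `[< nsg_set H (x^-1 * y) >].

Let HG : is_subgroup H := proj1 (nsg_normal H).
Let HJ : conj_invariant H := proj2 (nsg_normal H).

Lemma coset_equiv_class : equiv_class_of coset_rel.
Proof.
have rel_sym x y : coset_rel x y -> coset_rel y x.
  by move=> /asboolP/(subgroupV HG); rewrite invgM invgK => /asboolP.
split=> [x|x y|y x z /asboolP Hxy /asboolP Hyz].
- by apply/asboolP; rewrite mulVg; exact: (proj1 HG).
- by apply/idP/idP; apply: rel_sym.
- apply/asboolP; have := subgroupM HG Hxy Hyz.
  by rewrite mulgA mulgK.
Qed.

Canonical coset_equiv := EquivRelPack coset_equiv_class.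

Definition quot : Type := {eq_quot coset_equiv}.
HB.instance Definition _ := Choice.on quot.
HB.instance Definition _ := EqQuotient.on quot.

Definition coset : G -> quot := \pi_quot.

Lemma coset_eq x y : coset x = coset y <-> nsg_set H (x^-1 * y).
Proof.
rewrite /coset; split=> [/eqP|Hxy]; first by rewrite eqmodE => /asboolP.
by apply/eqP; rewrite eqmodE; apply/asboolP.
Qed.

Lemma coset_repr (u : quot) : coset (repr u) = u.
Proof. exact: reprK. Qed.

Lemma quot_ind (P : quot -> Prop) :
  (forall x, P (coset x)) -> forall u, P u.
Proof. by move=> Px u; rewrite -[u]coset_repr; exact: Px. Qed.

Definition quot_one : quot := coset 1.
Definition quot_inv (u : quot) : quot := coset (repr u)^-1.
Definition quot_mul (u v : quot) : quot := coset (repr u * repr v).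

Lemma cosetM_subproof x y : quot_mul (coset x) (coset y) = coset (x * y).
Proof.
have /coset_eq Hx := coset_repr (coset x).
have /coset_eq Hy := coset_repr (coset y).
apply/coset_eq; set a := repr (coset x) in Hx *; set b := repr (coset y) in Hy *.
have -> : (a * b)^-1 * (x * y) = (a^-1 * x) ^ b * (b^-1 * y).
  by rewrite conjgE invgM !mulgA mulgK.
by apply: subgroupM => //; apply: HJ.
Qed.

Lemma cosetV_subproof x : quot_inv (coset x) = coset x^-1.
Proof.
have /coset_eq Hx := coset_repr (coset x).
apply/coset_eq; set a := repr (coset x) in Hx *.
have -> : a^-1^-1 / x = ((a^-1 * x)^-1) ^ a^-1.
  by rewrite conjgE !invgM !invgK !mulgA mulgK.
by apply: HJ; apply: subgroupV.
Qed.

Lemma quot_mulA : associative quot_mul.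
Proof.
elim/quot_ind=> x; elim/quot_ind=> y; elim/quot_ind=> z.
by rewrite !cosetM_subproof mulgA.
Qed.

Lemma quot_mul1g : left_id quot_one quot_mul.
Proof. by elim/quot_ind=> x; rewrite cosetM_subproof mul1g. Qed.

Lemma quot_mulg1 : right_id quot_one quot_mul.
Proof. by elim/quot_ind=> x; rewrite cosetM_subproof mulg1. Qed.

Lemma quot_mulVg : left_inverse quot_one quot_inv quot_mul.
Proof.
by elim/quot_ind=> x; rewrite cosetV_subproof cosetM_subproof mulVg.
Qed.

Lemma quot_mulgV : right_inverse quot_one quot_inv quot_mul.
Proof.
by elim/quot_ind=> x; rewrite cosetV_subproof cosetM_subproof mulgV.
Qed.

HB.instance Definition _ := isGroup.Build quot
  quot_mulA quot_mul1g quot_mulg1 quot_mulVg quot_mulgV.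

Lemma cosetM : {morph coset : x y / x * y}.
Proof. by move=> x y; rewrite -cosetM_subproof. Qed.

HB.instance Definition _ := isMultiplicative.Build G quot coset cosetM.

Lemma coset_surj u : exists x, coset x = u.
Proof. by exists (repr u); exact: coset_repr. Qed.

End Quotient.

Section QuotientProjection.
Variables (G : groupType) (H K : normal_subgroup G).

(* The map xH |-> xK; the inclusion makes it independent of the chosen
   representative and is only used in the proofs below. *)
Definition quot_proj (HK : H `<=` K) (u : quot H) : quot K :=
  coset K (repr u).

Variable HK : H `<=` K.

Lemma quot_projE x : quot_proj HK (coset H x) = coset K x.
Proof. by apply/coset_eq/HK/coset_eq; exact: coset_repr. Qed.

Lemma quot_projM : {morph quot_proj HK : u v / u * v}.
Proof.
elim/quot_ind=> x; elim/quot_ind=> y.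
by rewrite -gmulfM !quot_projE gmulfM.
Qed.

HB.instance Definition _ :=
  isMultiplicative.Build (quot H) (quot K) (quot_proj HK) quot_projM.

Lemma quot_proj_surj v : exists u, quot_proj HK u = v.
Proof.
by elim/quot_ind: v => x; exists (coset H x); exact: quot_projE.
Qed.

Lemma quot_proj_eq1 u :
  quot_proj HK u = 1 <-> (exists2 x, nsg_set K x & coset H x = u).
Proof.
split=> [|[x Kx <-]]; last first.
  rewrite quot_projE -(mor1 (coset K)); apply/coset_eq.
  by rewrite mulg1; apply: subgroupV Kx; exact: (proj1 (nsg_normal K)).
elim/quot_ind: u => x; rewrite quot_projE -(mor1 (coset K)) => /esym/coset_eq.
by rewrite invg1 mul1g => Kx; exists x.
Qed.

End QuotientProjection.

Record subgroup (G : groupType) := Subgroup {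
  sg_set :> set G;
  sg_subgroup : is_subgroup sg_set
}.

Section SubgroupType.
Variables (G : groupType) (S : subgroup G).

Definition sg_type : Type := {x : G | x \in (S : set G)}.
HB.instance Definition _ := SubChoice.on sg_type.

Lemma sg_group_closed : group_closed (fun x : G => x \in (S : set G)).
Proof.
have [S1 SF] := sg_subgroup S; split; first exact/mem_set.
by move=> x y /set_mem Sx /set_mem Sy; apply/mem_set/SF.
Qed.

HB.instance Definition _ :=
  SubChoice_isSubGroup.Build G _ sg_type sg_group_closed.

End SubgroupType.

Section HomGroup.
Variables (A B : groupType).

(* Hom(A, B) as a group under the pointwise product, for B abelian. *)
Definition hom_group (cB : commutative (@mul B)) : Type :=
  {multiplicative A -> B}.

Variable cB : commutative (@mul B).

HB.instance Definition _ := gen_eqMixin (hom_group cB).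
HB.instance Definition _ := gen_choiceMixin (hom_group cB).

Definition hom_fun (f : hom_group cB) : A -> B :=
  (f : {multiplicative A -> B}).

Lemma hom_one_subproof : {morph (fun _ : A => 1 : B) : x y / x * y}.
Proof. by move=> x y; rewrite mulg1. Qed.

Definition hom_one : hom_group cB :=
  HB.pack_for {multiplicative A -> B} (fun _ : A => 1 : B)
    (isMultiplicative.Build A B _ hom_one_subproof).

Lemma hom_inv_subproof (f : hom_group cB) :
  {morph (fun x => (hom_fun f x)^-1) : x y / x * y}.
Proof. by move=> x y; rewrite /hom_fun gmulfM invgM cB. Qed.

Definition hom_inv (f : hom_group cB) : hom_group cB :=
  HB.pack_for {multiplicative A -> B} (fun x => (hom_fun f x)^-1)
    (isMultiplicative.Build A B _ (hom_inv_subproof f)).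

Lemma hom_mul_subproof (f g : hom_group cB) :
  {morph (fun x => hom_fun f x * hom_fun g x) : x y / x * y}.
Proof.
move=> x y; rewrite /hom_fun !gmulfM -!mulgA; congr (_ * _).
by rewrite !mulgA; congr (_ * _); rewrite cB.
Qed.

Definition hom_mul (f g : hom_group cB) : hom_group cB :=
  HB.pack_for {multiplicative A -> B} (fun x => hom_fun f x * hom_fun g x)
    (isMultiplicative.Build A B _ (hom_mul_subproof f g)).

Lemma hom_mulA : associative hom_mul.
Proof. by move=> f g h; apply: multiplicative_ext => x; exact: mulgA. Qed.

Lemma hom_mul1g : left_id hom_one hom_mul.
Proof. by move=> f; apply: multiplicative_ext => x; exact: mul1g. Qed.

Lemma hom_mulg1 : right_id hom_one hom_mul.
Proof. by move=> f; apply: multiplicative_ext => x; exact: mulg1. Qed.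

Lemma hom_mulVg : left_inverse hom_one hom_inv hom_mul.
Proof. by move=> f; apply: multiplicative_ext => x; exact: mulVg. Qed.

Lemma hom_mulgV : right_inverse hom_one hom_inv hom_mul.
Proof. by move=> f; apply: multiplicative_ext => x; exact: mulgV. Qed.

HB.instance Definition _ := isGroup.Build (hom_group cB)
  hom_mulA hom_mul1g hom_mulg1 hom_mulVg hom_mulgV.

End HomGroup.

Record aut (G : groupType) := Aut {
  aut_mor :> {multiplicative G -> G};
  aut_bij : bijective aut_mor
}.

Section AutGroup.
Variable G : groupType.

HB.instance Definition _ := gen_eqMixin (aut G).
HB.instance Definition _ := gen_choiceMixin (aut G).

Lemma aut_ext (f g : aut G) : (forall x, f x = g x) -> f = g.
Proof.
case: f g => f fB [g gB] /= /multiplicative_ext fg.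
by case: _ / fg gB => gB; rewrite (Prop_irrelevance fB gB).
Qed.

Lemma id_morph : {morph @id G : x y / x * y}. Proof. by []. Qed.

Definition aut_one : aut G :=
  @Aut G (HB.pack_for {multiplicative G -> G} (@id G)
            (isMultiplicative.Build G G _ id_morph))
         (inv_bij (fun=> erefl)).

Lemma comp_morph (f g : aut G) : {morph (fun x => f (g x)) : x y / x * y}.
Proof. by move=> x y; rewrite !gmulfM. Qed.

Definition aut_mul (f g : aut G) : aut G :=
  @Aut G (HB.pack_for {multiplicative G -> G} (fun x => f (g x))
            (isMultiplicative.Build G G _ (comp_morph f g)))
         (bij_comp (aut_bij f) (aut_bij g)).

Lemma aut_inv_ex (f : aut G) : exists g : aut G, cancel f g /\ cancel g f.
Proof.
have [g fK gK] := aut_bij f.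
have gM : {morph g : x y / x * y}.
  by move=> x y; rewrite -{1}(gK x) -{1}(gK y) -gmulfM fK.
pose g' := HB.pack_for {multiplicative G -> G} g (isMultiplicative.Build G G _ gM).
have gB : bijective g' by exists f.
by exists (Aut gB).
Qed.

Definition aut_inv (f : aut G) : aut G := projT1 (cid (aut_inv_ex f)).

Lemma aut_invK (f : aut G) : cancel f (aut_inv f).
Proof. by rewrite /aut_inv; case: cid => g []. Qed.

Lemma aut_invVK (f : aut G) : cancel (aut_inv f) f.
Proof. by rewrite /aut_inv; case: cid => g []. Qed.

Lemma aut_mulA : associative aut_mul.
Proof. by move=> f g h; apply: aut_ext. Qed.

Lemma aut_mul1g : left_id aut_one aut_mul.
Proof. by move=> f; apply: aut_ext. Qed.

Lemma aut_mulg1 : right_id aut_one aut_mul.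
Proof. by move=> f; apply: aut_ext. Qed.

Lemma aut_mulVg : left_inverse aut_one aut_inv aut_mul.
Proof. by move=> f; apply: aut_ext => x; exact: aut_invK. Qed.

Lemma aut_mulgV : right_inverse aut_one aut_inv aut_mul.
Proof. by move=> f; apply: aut_ext => x; exact: aut_invVK. Qed.

HB.instance Definition _ := isGroup.Build (aut G)
  aut_mulA aut_mul1g aut_mulg1 aut_mulVg aut_mulgV.

End AutGroup.

Section ModpQuotients.
Variables (b : modp_kind) (p : nat) (G : groupType).

Definition modp_nsg (k : nat) : normal_subgroup G :=
  NormalSubgroup (@modp_series_normal G b p k).

(* Note the shift: N_k = G / G_(k+1). *)
Definition modp_quot (k : nat) : Type := quot (modp_nsg k.+1).
HB.instance Definition _ k := Group.on (modp_quot k).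

Definition modp_trunc (j k : nat) (jk : (j <= k)%N) :
    modp_quot k -> modp_quot j :=
  @quot_proj G (modp_nsg k.+1) (modp_nsg j.+1)
    (@modp_series_le G b p j.+1 k.+1 jk).

HB.instance Definition _ j k (jk : (j <= k)%N) :=
  Multiplicative.on (modp_trunc jk).

Definition layer_set (k : nat) : set (modp_quot k) :=
  coset (modp_nsg k.+1) @` modp_series b p G k.

Lemma layer_subgroup k : is_subgroup (@layer_set k).
Proof.
apply: image_subgroup; exact: (proj1 (@modp_series_normal G b p k)).
Qed.

(* The group G_k / G_(k+1), realized as the subgroup of G / G_(k+1) of
   classes of elements of G_k. *)
Definition modp_layer (k : nat) : Type := sg_type (Subgroup (layer_subgroup k)).
HB.instance Definition _ k := Group.on (modp_layer k).

Definition layer_incl (k : nat) (u : modp_layer k) : modp_quot k := val u.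

End ModpQuotients.

Arguments modp_nsg b p G k : clear implicits.
Arguments modp_quot b p G k : clear implicits.
Arguments modp_layer b p G k : clear implicits.
Arguments layer_set b p G k : clear implicits.
Arguments modp_trunc b p G {j k} jk u.

Section InducedAut.
Variables (b : modp_kind) (p : nat) (G : groupType) (k : nat).
Local Notation N := (modp_quot b p G).
Local Notation L := (layer_set b p G).
Local Notation pr := (modp_trunc b p G (leqnSn k)).

Lemma layer_series j : L j = modp_series b p (N j) j.
Proof.
apply/seteqP; split; first exact: modp_series_mor.
exact/modp_series_surj/coset_surj.
Qed.

Lemma layer_char (f : {multiplicative N k.+1 -> N k.+1}) u :
  L k.+1 u -> L k.+1 (f u).
Proof.
by rewrite !layer_series => Lu; apply: (@modp_series_mor _ _ f); exists u.
Qed.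

Lemma trunc_eq1 (u : N k.+1) : pr u = 1 <-> L k.+1 u.
Proof. exact: quot_proj_eq1. Qed.

Lemma trunc_eq (u v : N k.+1) : pr u = pr v <-> pr (u^-1 * v) = 1.
Proof.
have -> : pr (u^-1 * v) = (pr u)^-1 * pr v by rewrite gmulfM morV.
split=> [->|uv]; first by rewrite mulVg.
by apply: invg_inj; apply: divg1_eq; rewrite invgK.
Qed.

Definition trunc_lift (v : N k) : N k.+1 := coset _ (repr v).

Lemma trunc_liftK : cancel trunc_lift pr.
Proof. by move=> v; rewrite [LHS]quot_projE; exact: coset_repr. Qed.

Definition psi_fun (f : aut (N k.+1)) (v : N k) : N k :=
  pr (f (trunc_lift v)).

Lemma psi_fun_trunc f u : psi_fun f (pr u) = pr (f u).
Proof.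
apply/trunc_eq; rewrite -morV -gmulfM; apply/trunc_eq1/layer_char/trunc_eq1.
by apply/trunc_eq; rewrite trunc_liftK.
Qed.

Lemma psi_funM f : {morph psi_fun f : u v / u * v}.
Proof.
move=> u v; rewrite -(trunc_liftK u) -(trunc_liftK v) -gmulfM !psi_fun_trunc.
by rewrite !gmulfM.
Qed.

Lemma psi_fun_comp f g v : psi_fun (f * g) v = psi_fun f (psi_fun g v).
Proof. by rewrite -(trunc_liftK v) !psi_fun_trunc. Qed.

Lemma psi_fun1 v : psi_fun 1 v = v.
Proof. by rewrite -(trunc_liftK v) psi_fun_trunc. Qed.

Lemma psi_fun_bij f : bijective (psi_fun f).
Proof.
by exists (psi_fun f^-1) => v; rewrite -psi_fun_comp ?mulVg ?mulgV psi_fun1.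
Qed.

(* The automorphism of N_k induced by an automorphism of N_(k+1); it is
   characterized by psi_trunc. *)
Definition psi (f : aut (N k.+1)) : aut (N k) :=
  @Aut (N k) (HB.pack_for {multiplicative N k -> N k} (psi_fun f)
                (isMultiplicative.Build (N k) (N k) _ (psi_funM f)))
       (psi_fun_bij f).

Lemma psi_trunc f u : psi f (pr u) = pr (f u).
Proof. exact: psi_fun_trunc. Qed.

Lemma psiM : {morph psi : f g / f * g}.
Proof. by move=> f g; apply: aut_ext => v; exact: psi_fun_comp. Qed.

HB.instance Definition _ :=
  isMultiplicative.Build (aut (N k.+1)) (aut (N k)) psi psiM.

End InducedAut.

Arguments psi b p G k f : clear implicits.

(* Exactness of 1 -> A -> B -> C -> 1. *)
Definition short_exact (A B C : groupType) (i : {multiplicative A -> B})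
    (q : {multiplicative B -> C}) : Prop :=
  [/\ injective i,
      range i = q @^-1` [set 1]
    & forall c, exists b, q b = c].

(* Main.v *)
(* Everything rests on G_(k+1) being central of exponent p modulo G_(k+2). For
   the Zassenhaus series, centrality means that if y lies in gamma_i and c in
   gamma_(i+1), then y ^- q * (y * c) ^+ q lies in the (i q + 1)-st term, for
   q = p ^ j. The sequence g n = y ^- n * (y * c) ^+ n is polynomial in the
   sense of Lazard and Leibman: its m-th difference takes values in
   gamma_(m i + 1). Hence g q is a product of elements g_l ^+ 'C(q, l) with g_l
   in gamma_(l i + 1), and p ^ (j - v_p(l)) divides 'C(p ^ j, l).

   Then an endomorphism f of N_(k+1) over the identity of N_k differs from the
   identity by the homomorphism u |-> f u / u to an abelian group of exponent
   p, which factors through N_1. By freeness, an automorphism of N_k and its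
   inverse both lift to endomorphisms of N_(k+1); their two composites are over
   the identity, hence bijective. *)
Require Import Defs.
From HB Require Import structures.
From mathcomp Require Import all_boot zify.
From mathcomp Require Import boolp classical_sets.
Set Implicit Arguments.
Unset Strict Implicit.
Unset Printing Implicit Defensive.
Local Open Scope classical_set_scope.
Local Open Scope group_scope.

(** By the absorption identity, [p ^ j] divides [k * 'C(p ^ j, k)]; comparing p-adic valuations
    gives the claim. *)
Lemma dvdn_pfactor_bin p j k : prime p -> (0 < k <= p ^ j)%N ->
  (p ^ (j - logn p k) %| 'C(p ^ j, k))%N.
Proof.
move=> pP /andP[k0 kq]; have q0 : (0 < p ^ j)%N by rewrite expn_gt0 prime_gt0.
have C0 : (0 < 'C(p ^ j, k))%N by rewrite bin_gt0.
rewrite pfactor_dvdn // leq_subLR -lognM //.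
rewrite -[X in (X <= _)%N](pfactorK j pP) dvdn_leq_log ?muln_gt0 ?k0 //.
by case: k k0 {kq C0} => // k _; rewrite -mul_bin_diag dvdn_mulr.
Qed.

(** * Commutator identities *)

Section CommutatorIdentities.
Variable G : groupType.
Implicit Types x y z u v : G.

Lemma commMgR x y z : [~ x * y, z] = [~ x, z] ^ y * [~ y, z].
Proof. by rewrite /commg /conjg !gnorm. Qed.

Lemma conjg_mulR x y : x ^ y = x * [~ x, y].
Proof. by rewrite /commg /conjg !gnorm. Qed.

Lemma Hall_Witt x y z :
  [~ x, y^-1, z] ^ y * [~ y, z^-1, x] ^ z * [~ z, x^-1, y] ^ x = 1.
Proof. by rewrite /commg /conjg !gnorm. Qed.

Lemma commVg x y : [~ x^-1, y] = ([~ x, y] ^ x^-1)^-1.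
Proof. by rewrite /commg /conjg !gnorm. Qed.

Lemma normalR (N : set G) x y : is_normal N -> N x -> N [~ x, y].
Proof.
by move=> [NG NJ] Nx; apply: subgroupM; [|exact: subgroupV|exact: NJ].
Qed.

(** The product rule for commutators and normality of [N] give closure. Commutator conditions can
    thus be checked on generators of the first argument. *)
Lemma centralized_subgroup (N B : set G) : is_normal N ->
  is_subgroup [set x | forall y, B y -> N [~ x, y]].
Proof.
move=> [NG NJ]; split=> [y _|x x' Hx Hx' y By].
  by rewrite comm1g; case: NG.
rewrite commMgR commVg; apply: (proj2 NG); last exact/NJ/Hx'.
exact/NJ/Hx.
Qed.

End CommutatorIdentities.

(** * Commutators in the lower central series *)

Section LowerCentral.
Variable G : groupType.
Local Notation gam := (lower_central G).

Lemma lower_central_le m n : (m <= n)%N -> gam n `<=` gam m.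
Proof.
move=> mn; rewrite -(subnK mn); elim: (n - m)%N => [//|d IHd].
rewrite addSn; apply: subset_trans IHd.
case: (d + m)%N => [//|l]; have [gG gJ] := lower_central_normal G l.+1.
apply: generated_sub => // _ [x _ [y gy <-]].
by rewrite -invgR; apply: subgroupV => //; exact: normalR.
Qed.

(** Three subgroups argument: for a generator [[~ g, u]], the Hall-Witt identity expresses
    [[~ g, u, y]] through two commutators that the induction hypothesis controls. *)
Lemma lower_central_comm m n x y :
  gam m x -> gam n y -> gam (m + n)%N [~ x, y].
Proof.
elim: m n x y => [|m IHm] n x y gx gy.
  by rewrite -invgR; have gN := lower_central_normal G n;
    apply: subgroupV; [exact: (proj1 gN)|exact: normalR].
case: m => [|m] in IHm gx *.
  by case: n gy => [//|n] gy; apply: sub_generated; exists x => //; exists y.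
have gN := lower_central_normal G (m.+2 + n).
move: x gx y gy; apply: generated_sub; first exact: centralized_subgroup.
move=> _ [g _ [u gu <-]] y gy.
have gG := proj1 gN; have gG' k := proj1 (lower_central_normal G k).
have S k z : gam k.+1 z -> gam k.+2 [~ z, g].
  move=> gz; rewrite -invgR; apply: (subgroupV (gG' _)).
  by apply: sub_generated; exists g => //; exists z.
have E1 : gam (m.+2 + n)%N [~ u^-1, y^-1, g].
  rewrite !addSn; apply: S; rewrite -addSn.
  by apply: IHm; exact: (subgroupV (gG' _)).
have E2 : gam (m.+2 + n)%N [~ y, g^-1, u^-1].
  rewrite -invgR; apply: (subgroupV gG).
  have -> : (m.+2 + n = m.+1 + n.+1)%N by lia.
  apply: IHm; first exact: (subgroupV (gG' _)).
  case: n gy {gN gG E1} => [//|n] gy.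
  rewrite -invgR; apply: (subgroupV (gG' _)).
  by apply: sub_generated; exists g^-1 => //; exists y.
have := Hall_Witt g u^-1 y; rewrite invgK -mulgA => /mulg1_eq /esym E3.
rewrite -[[~ _, _]](conjgK u^-1); apply: (proj2 gN); rewrite -[_ ^ _]invgK.
apply: (subgroupV gG); rewrite -E3.
by apply: (subgroupM gG); apply: (proj2 gN).
Qed.

End LowerCentral.

(** * Polynomial sequences in a filtered group *)

Section PolynomialSequences.
Variables (G : groupType) (H : nat -> set G).
Hypothesis HN : forall n, is_normal (H n).
Hypothesis Hle : forall m n, (m <= n)%N -> H n `<=` H m.
Hypothesis HR : forall m n x y, H m x -> H n y -> H (m + n)%N [~ x, y].
Implicit Types (f g : nat -> G).

Let HG n : is_subgroup (H n) := proj1 (HN n).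
Let H1 n : H n 1 := proj1 (HG n).

Definition seq_diff f : nat -> G := fun n => (f n)^-1 * f n.+1.

(* The [m]-th difference of [f] takes values in [H (a + m * i)], for
   [m <= d]. *)
Fixpoint poly_seq (i d a : nat) f : Prop :=
  (forall n, H a (f n)) /\
  (if d is d'.+1 then poly_seq i d' (a + i)%N (seq_diff f) else True).

Variable i : nat.
Local Notation poly := (poly_seq i).

Lemma poly_seq_val d a f n : poly d a f -> H a (f n).
Proof. by case: d => [|d] []. Qed.

Lemma poly_seq_diff d a f : poly d.+1 a f -> poly d (a + i)%N (seq_diff f).
Proof. by case. Qed.

Lemma eq_poly_seq d a f g : f =1 g -> poly d a f -> poly d a g.
Proof. by move=> /funext->. Qed.

Lemma poly_seq_depthS d a f : poly d.+1 a f -> poly d a f.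
Proof.
elim: d a f => [|d IHd] a f [Hf Df]; first by split.
by split=> //; apply: IHd.
Qed.

Lemma poly_seq_le d a b f : (a <= b)%N -> poly d b f -> poly d a f.
Proof.
elim: d a b f => [|d IHd] a b f ab [Hf Df]; split=> //.
- by move=> n; exact: Hle (Hf n).
- by move=> n; exact: Hle (Hf n).
- by apply: IHd Df; rewrite leq_add2r.
Qed.

(* Both closure properties are proved together because the difference of a
   product involves commutators, and conversely. *)
Lemma poly_seqM_R d :
  (forall a f g, poly d a f -> poly d a g -> poly d a (fun n => f n * g n)) /\
  (forall a b f g, poly d a f -> poly d b g ->
     poly d (a + b)%N (fun n => [~ f n, g n])).
Proof.
elim: d => [|d [IHM IHR]].
  split=> [a f g [Hf _] [Hg _]|a b f g [Hf _] [Hg _]]; split=> // n.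
    exact: (subgroupM (HG _)).
  exact: HR.
have IHJ a b f g : poly d a f -> poly d b g -> poly d a (fun n => f n ^ g n).
  move=> Pf Pg; apply: (@eq_poly_seq _ _ (fun n => f n * [~ f n, g n])).
    by move=> n; rewrite -conjg_mulR.
  by apply: IHM => //; apply: poly_seq_le (IHR _ _ _ _ Pf Pg); lia.
split=> [a f g Pf Pg|a b f g Pf Pg]; split.
- move=> n; apply: (subgroupM (HG _)).
    exact: poly_seq_val Pf.
  exact: poly_seq_val Pg.
- have E n : seq_diff f n ^ g n * seq_diff g n =
             seq_diff (fun n => f n * g n) n.
    by rewrite /seq_diff /conjg !gnorm.
  apply: (eq_poly_seq E); apply: IHM; last exact: poly_seq_diff.
  apply: (IHJ _ a); first exact: poly_seq_diff.
  exact: poly_seq_depthS.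
- by move=> n; apply: HR; [exact: poly_seq_val Pf|exact: poly_seq_val Pg].
- pose u := seq_diff f; pose v := seq_diff g; pose w n := [~ f n, g n].
  have Pu : poly d (a + i)%N u by exact: poly_seq_diff.
  have Pv : poly d (b + i)%N v by exact: poly_seq_diff.
  have {}Pf := poly_seq_depthS Pf; have {}Pg := poly_seq_depthS Pg.
  have Pw : poly d (a + b)%N w by exact: IHR.
  pose X n := [~ f n, v n] ^ u n * [~ u n, v n].
  (* Every factor on the left involves a difference [u] or [v], so its weight is at least
     [a + b + i]. *)
  have E n : X n ^ w n * [~ w n, u n * v n] * [~ u n, g n] ^ v n =
             seq_diff w n.
    have fE : f n.+1 = f n * u n by rewrite /u /seq_diff mulVKg.
    have gE : g n.+1 = g n * v n by rewrite /v /seq_diff mulVKg.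
    rewrite /seq_diff /X /w fE gE; move: (f n) (g n) (u n) (v n) => x y z t.
    by rewrite /commg /conjg !gnorm.
  apply: (eq_poly_seq E); apply: (IHM); first apply: (IHM).
  + apply: (IHJ _ (a + b)%N) => //; apply: IHM.
      by apply: (IHJ _ (a + i)%N) => //; rewrite -addnA; exact: IHR.
    by apply: poly_seq_le (IHR _ _ _ _ Pu Pv); lia.
  + have ui : poly d i u by apply: poly_seq_le Pu; lia.
    have vi : poly d i v by apply: poly_seq_le Pv; lia.
    by apply: IHR => //; apply: IHM.
  + apply: (IHJ _ (b + i)%N) => //.
    by rewrite addnAC; exact: IHR.
Qed.

Lemma poly_seqM d a f g :
  poly d a f -> poly d a g -> poly d a (fun n => f n * g n).
Proof. exact: (proj1 (poly_seqM_R d)). Qed.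

Lemma poly_seqR d a b f g :
  poly d a f -> poly d b g -> poly d (a + b)%N (fun n => [~ f n, g n]).
Proof. exact: (proj2 (poly_seqM_R d)). Qed.

Lemma poly_seq_cst d a x : H a x -> poly d a (fun=> x).
Proof.
elim: d a x => [|d IHd] a x Hx; split=> //.
apply: (@eq_poly_seq _ _ (fun=> 1)); last exact: IHd.
by move=> n; rewrite /seq_diff mulVg.
Qed.

(** By Pascal's rule, a difference lowers [l] by one and uses up one [i] of the weight of [x]; at
    [l = 0] the sequence is constant. *)
Lemma poly_seq_bin d a l x : H (a + l * i)%N x ->
  poly d a (fun n => x ^+ 'C(n, l)).
Proof.
have val_a a' l' : H (a' + l' * i)%N x -> forall n, H a' (x ^+ 'C(n, l')).
  by move=> Hx n; apply: (subgroupX _ (HG _)); apply: Hle Hx; exact: leq_addr.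
elim: d a l => [|d IHd] a l Hx; split=> //; try exact: val_a.
case: l Hx => [|l] Hx.
  apply: (@eq_poly_seq _ _ (fun=> 1)); last exact: poly_seq_cst.
  by move=> n; rewrite /seq_diff !bin0 mulVg.
apply: (@eq_poly_seq _ _ (fun n => x ^+ 'C(n, l))).
  by move=> n; rewrite /seq_diff binS expgnDr mulKg.
by apply: IHd; rewrite -addnA -mulSn.
Qed.

(** For [f] trivial before [k], the value [f k] is the [k]-th difference of [f] at 0. *)
Lemma poly_seq_leading d a f k : (k <= d)%N -> poly d a f ->
  (forall m, (m < k)%N -> f m = 1) -> H (a + k * i)%N (f k).
Proof.
elim: k d a f => [|k IHk] [|d] a f // kd Pf f1.
- by rewrite addn0; exact: poly_seq_val Pf.
- by rewrite addn0; exact: poly_seq_val Pf.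
have := IHk d (a + i)%N (seq_diff f) kd (poly_seq_diff Pf).
rewrite /seq_diff (f1 k) // invg1 mul1g -addnA -mulSn; apply.
by move=> m mk; rewrite !f1 ?mulVg //; lia.
Qed.

(* Subtracting leading terms, [f q] is a product of the elements
   [g_l ^+ 'C(q, l)] with [g_l] in [H (a + l * i)]. *)
Lemma poly_seq_eval (K : set G) q a f k : is_subgroup K ->
  (forall l x, (k <= l <= q)%N -> H (a + l * i)%N x -> K (x ^+ 'C(q, l))) ->
  poly q a f -> (forall m, (m < k)%N -> f m = 1) -> K (f q).
Proof.
move=> KG; have [e] := ubnP (q.+1 - k); elim: e => // e IHe in k f *.
move=> ke HK Pf f1; have [qk|kq] := ltnP q k.
  by rewrite f1 //; case: KG.
have Hk := poly_seq_leading kq Pf f1.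
(* The correction also kills the value at [k], since ['C(k, k) = 1], and leaves earlier values
   alone, since ['C(m, k) = 0] for [m < k]. *)
pose f' n := (f k)^-1 ^+ 'C(n, k) * f n.
have -> : f q = f k ^+ 'C(q, k) * f' q by rewrite /f' expVgn mulVKg.
apply: (subgroupM KG); first by apply: HK => //; rewrite leqnn.
apply: (IHe k.+1); first by lia.
- by move=> l x kl; apply: HK; lia.
- by apply: poly_seqM => //; apply: poly_seq_bin; exact: (subgroupV (HG _)).
move=> m; rewrite ltnS leq_eqVlt /f' => /predU1P[->|mk].
  by rewrite binn mulVg.
by rewrite bin_small // expg0 mul1g f1.
Qed.

(* The difference of [g n = y ^- n * (y * c) ^+ n] is [[~ g n, y] * c]. *)
Lemma poly_seq_expg d y c : H i y -> H i.+1 c ->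
  poly d 1 (fun n => y ^- n * (y * c) ^+ n).
Proof.
move=> Hy Hc.
have Hg n : H 1 (y ^- n * (y * c) ^+ n).
  elim: n => [|n IHn]; first by rewrite !expg0 invg1 mulg1.
  rewrite !expgSr invgM.
  move: (y ^- n) ((y * c) ^+ n) IHn => z t IHn.
  have -> : y^-1 * z * (t * (y * c)) = (z * t) ^ y * c.
    by rewrite /conjg !mulgA.
  by apply: (subgroupM (HG _)) => //; [apply: (proj2 (HN 1))|apply: Hle Hc].
(* The commutator with [y] adds [i] to the weight 1 of the sequence, and [c] has weight [1 + i]
   already. *)
elim: d => [|d IHd]; split=> //.
apply: (@eq_poly_seq _ _
    (fun n => [~ y ^- n * (y * c) ^+ n, y] * c)) => [n|].
  rewrite /seq_diff !expgSr.
  by move: (y ^+ n) ((y * c) ^+ n) => u v; rewrite /commg /conjg !gnorm.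
apply: poly_seqM; last by apply: poly_seq_cst; rewrite add1n.
by apply: poly_seqR => //; exact: poly_seq_cst.
Qed.

End PolynomialSequences.

(** * Centrality of the Zassenhaus series *)

Section Central.
Variables (p : nat) (G : groupType).
Hypothesis pP : prime p.

Lemma zassenhaus_expg n i j x : (0 < i)%N -> (n <= i * p ^ j)%N ->
  lower_central G i x -> zassenhaus G p n (x ^+ (p ^ j)).
Proof.
move=> i0 nij gx; apply: sub_generated; exists (i, j) => //.
by apply: sub_generated; exists x.
Qed.

Lemma zassenhaus_central n x y : zassenhaus G p n x ->
  zassenhaus G p n.+1 [~ x, y].
Proof.
move=> Zx; suff : [set x | forall y, setT y -> zassenhaus G p n.+1 [~ x, y]] x.
  exact.
have ZN := zassenhaus_normal G p n.+1.
move: x Zx {y}; apply: generated_sub; first exact: centralized_subgroup.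
move=> x [[i j] /= [i0 nij]]; move: x.
apply: generated_sub; first exact: centralized_subgroup.
(* With [q = p ^ j], this is [[~ y ^+ q, x] = y ^- q * (y * [~ y, x]) ^+ q]. *)
move=> _ [y gy <-] x _; rewrite commgEl conjXg conjg_mulR.
have gc : lower_central G i.+1 [~ y, x].
  by rewrite -addn1; apply: lower_central_comm.
have Pf := poly_seq_expg (lower_central_normal G) (@lower_central_le G)
  (@lower_central_comm G) (p ^ j) gy gc.
(* The sequence is trivial at 0, so the expansion starts at [k := 1] and only binomials with [l > 0]
   occur. *)
apply: (poly_seq_eval (lower_central_normal G) (@lower_central_le G)
  (@lower_central_comm G) (k := 1) (proj1 ZN) _ Pf) => [l z l1 gz|]; last first.
  by case=> // _; rewrite !expg0 invg1 mulg1.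
have /dvdnP[r ->] := dvdn_pfactor_bin pP l1.
rewrite mulnC expgnA; apply: (subgroupX _ (proj1 ZN)).
apply: zassenhaus_expg gz => //.
have [l0 lq] := andP l1.
(* Write [p ^ j = s * t] with [t = p ^ logn p l <= l]. Then [(1 + l * i) * s >= s + i * s * t >= 1 +
   n]. *)
have rl : (p ^ logn p l <= l)%N by rewrite dvdn_leq ?pfactor_dvdnn.
have rj : (logn p l <= j)%N.
  by rewrite -(leq_exp2l _ _ (prime_gt1 pP)); exact: leq_trans lq.
have qE : (p ^ j = p ^ (j - logn p l) * p ^ logn p l)%N.
  by rewrite -expnD subnK.
have s0 : (0 < p ^ (j - logn p l))%N by rewrite expn_gt0 prime_gt0.
move: {z Pf} (p ^ (j - _))%N (p ^ logn p l)%N s0 rl qE nij => s t s0 tl -> nij.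
rewrite mulnDl mul1n -add1n leq_add //; apply: leq_trans nij _.
by rewrite mulnA [leqLHS]mulnC -mulnA leq_mul2r tl orbT.
Qed.
End Central.

(** * Homomorphisms out of quotients and free groups *)

Lemma coset_eq1 (G : groupType) (H : normal_subgroup G) x :
  coset H x = 1 <-> nsg_set H x.
Proof.
rewrite -(mor1 (coset H)); split=> [/esym /coset_eq|Hx].
  by rewrite invg1 mul1g.
by apply/esym/coset_eq; rewrite invg1 mul1g.
Qed.

Lemma subgroup1 (G : groupType) : is_subgroup [set 1 : G].
Proof. by split=> // x y -> ->; rewrite mulgV. Qed.

Lemma factor_multiplicative (A B C : groupType) (q : {multiplicative A -> B})
    (h : {multiplicative A -> C}) :
  (forall v, exists u, q u = v) -> (forall u, q u = 1 -> h u = 1) ->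
  exists g : {multiplicative B -> C}, forall u, g (q u) = h u.
Proof.
move=> /choice[s qs] qh.
have sE u : h (s (q u)) = h u.
  apply: divg1_eq; rewrite -morV -gmulfM; apply: qh.
  by rewrite gmulfM morV qs mulgV.
have hsM : {morph (h \o s) : u v / u * v}.
  by move=> u v /=; rewrite -gmulfM -[RHS]sE gmulfM !qs.
by exists (HB.pack_for {multiplicative B -> C} (h \o s)
             (isMultiplicative.Build B C _ hsM)).
Qed.

(** Projectivity of free groups: basis images are lifted by choice, and uniqueness in the universal
    property identifies [q \o g] with [h]. *)
Lemma free_lift (F A B : groupType) (q : {multiplicative A -> B})
    (h : {multiplicative F -> B}) :
  free_of_finite_rank F -> (forall v, exists u, q u = v) ->
  exists g : {multiplicative F -> A}, forall w, q (g w) = h w.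
Proof.
move=> [n [x free_x]] /choice[s qs].
have [g [gx _]] := free_x A (fun i => s (h (x i))).
have [f [_ f_uniq]] := free_x B (fun i => h (x i)).
have fh : f = h by apply: f_uniq.
have fg : f = q \o g :> {multiplicative F -> B}.
  by apply: f_uniq => i /=; rewrite gx qs.
by exists g => w; rewrite -fh fg.
Qed.

(** * Centrality and exponent p for both series *)

Section Series.
Variables (p : nat) (b : modp_kind).
Hypothesis pP : prime p.

Lemma modp_series_central (G : groupType) k x y : (0 < k)%N ->
  modp_series b p G k x -> modp_series b p G k.+1 [~ x, y].
Proof.
case: b => /=; last by move=> _; exact: zassenhaus_central.
case: k => // k _ Sx; have SG := proj1 (stallings_normal G p k.+2).
rewrite -invgR; apply: (subgroupV SG).
exists [~ y, x]; first by apply: sub_generated; exists y => //; exists x.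
exists 1; last by rewrite mulg1.
exact: (proj1 (generated_subgroup _)).
Qed.

Lemma modp_series_expg (G : groupType) k x : (0 < k)%N ->
  modp_series b p G k x -> modp_series b p G k.+1 (x ^+ p).
Proof.
case: b => k0 /=.
  case: k k0 => // k _ Sx; exists 1.
    exact: (proj1 (generated_subgroup _)).
  by exists (x ^+ p); rewrite ?mul1g //; apply: sub_generated; exists x.
have ZG n := proj1 (zassenhaus_normal G p n).
(* Modulo the next term, elements of the [k]-th term commute, so their p-th power map is
   multiplicative and [K] is a subgroup. It then suffices to treat generators. *)
set K := [set x | zassenhaus G p k x /\ zassenhaus G p k.+1 (x ^+ p)].
have KG : is_subgroup K.
  split=> [|y z [Zy Zyp] [Zz Zzp]].
    by split; rewrite ?expg1n; exact: (proj1 (ZG _)).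
  split; first exact: (proj2 (ZG k)).
  pose Z := NormalSubgroup (zassenhaus_normal G p k.+1).
  apply/(coset_eq1 Z); rewrite morX gmulfM morV.
  rewrite expgnFl; last first.
    apply/commgP/eqP; rewrite -morR; apply/coset_eq1.
    exact: zassenhaus_central.
  have [/(coset_eq1 Z) cy /(coset_eq1 Z) cz] := conj Zyp Zzp.
  by rewrite -!morX /= cy cz mulgV.
suff sub : zassenhaus G p k `<=` K by move=> /sub[].
apply: generated_sub => // {}x [[i j] /= [i0 kij]]; move: x.
apply: generated_sub => // _ [x gx <-]; split.
  exact: zassenhaus_expg gx.
rewrite -expgnA -expnSr; apply: zassenhaus_expg gx => //.
(* As [p >= 2] and [k > 0], [p * (i * p ^ j) >= 2 * k >= k + 1]. *)
rewrite expnS mulnCA (leq_trans _ (leq_mul (prime_gt1 pP) (leqnn _))) //; lia.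
Qed.

(** In the Zassenhaus case [i * p ^ j >= 2] forces [i >= 2], where commutators vanish, or [j >= 1],
    where p-th powers vanish. *)
Lemma modp_series_abelian (A : groupType) x : commutative (@mul A) ->
  (forall x : A, x ^+ p = 1) -> modp_series b p A 2 x -> x = 1.
Proof.
move=> cA Ap; have A1 := subgroup1 A.
have comm1 : commutator [set: A] setT `<=` [set 1].
  apply: generated_sub => // _ [u _ [v _ <-]].
  by apply/eqP/commgP; exact: cA.
case: b => /=.
  move=> [u /comm1-> [v pv <-]]; rewrite mul1g.
  suff /(_ _ pv) : power_subgroup p [set: A] `<=` [set 1] by [].
  by apply: generated_sub => // _ [w _ <-]; exact: Ap.
suff sub : zassenhaus A p 2 `<=` [set 1] by exact: sub.
apply: generated_sub => // {}x [[i j] /= [i0 ij2]]; move: x.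
apply: generated_sub => // _ [u gu <-].
have [i1|i2] := leqP i 1; last first.
  by rewrite [u](comm1 _ (lower_central_le i2 gu)) /= expg1n.
case: j ij2 => [|j _]; first by rewrite expn0 muln1 ltnNge i1.
by rewrite expnS expgnA Ap /= expg1n.
Qed.

End Series.

(** * Translations and the kernel of [psi] *)

Section Translations.
Variables (p : nat) (b : modp_kind) (G : groupType) (k : nat).
Hypotheses (pP : prime p) (k0 : (0 < k)%N).
Local Notation N := (modp_quot b p G).
Local Notation L := (modp_layer b p G k.+1).
Local Notation pr := (modp_trunc b p G (leqnSn k)).
Local Notation ab := (modp_trunc b p G (ltn0Sn k)).
Local Notation incl := (@layer_incl b p G k.+1).

Lemma layer_central (u v : N k.+1) :
  layer_set b p G k.+1 u -> u * v = v * u.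
Proof.
move=> [x Sx <-]; elim/quot_ind: v => y; apply/commgP/eqP.
by rewrite -morR; apply/coset_eq1; exact: modp_series_central.
Qed.

Lemma layer_incl_central (u : L) v : incl u * v = v * incl u.
Proof. by apply: layer_central; exact: set_mem (valP u). Qed.

Lemma layer_inclM (u v : L) : incl (u * v) = incl u * incl v.
Proof. exact: valM. Qed.

Lemma layer_commutative : commutative (@mul L).
Proof.
move=> u v; apply: val_inj; rewrite -[LHS]/(incl _) -[RHS]/(incl _).
rewrite !layer_inclM.
exact: layer_incl_central.
Qed.

Lemma layer_expg (u : L) : u ^+ p = 1.
Proof.
apply: val_inj; rewrite gmulfXn gmulf1 /=.
have [x Sx <-] := set_mem (valP u).
by rewrite -morX; apply/coset_eq1; exact: modp_series_expg.
Qed.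

Lemma ab_layer_incl (u : L) : ab (incl u) = 1.
Proof.
apply/quot_proj_eq1; have [x Sx xu] := set_mem (valP u).
by exists x => //; apply: modp_series_le Sx.
Qed.

Lemma pr_layer_incl (u : L) : pr (incl u) = 1.
Proof. by apply/trunc_eq1; exact: set_mem (valP u). Qed.

(** The kernel of [ab] comes from the second term of [G], which goes to the second term of [L], a
    trivial group. *)
Lemma multiplicative_ab (h : {multiplicative N k.+1 -> L}) u :
  ab u = 1 -> h u = 1.
Proof.
move=> /(@quot_proj_eq1 G (modp_nsg b p G k.+2) (modp_nsg b p G 2)
            (@modp_series_le G b p 2 k.+2 (ltn0Sn k)))[x Sx <-].
apply: (@modp_series_abelian p b _ _ layer_commutative layer_expg).
apply: (@modp_series_mor _ _ (h \o coset _)).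
by exists x.
Qed.

Local Notation hom := (hom_group (N 1) layer_commutative).
Implicit Types f g : hom.

Definition translate f (u : N k.+1) : N k.+1 := incl (hom_fun f (ab u)) * u.

Lemma translateM f : {morph translate f : u v / u * v}.
Proof.
move=> u v; rewrite /translate /hom_fun !gmulfM layer_inclM -!mulgA.
by congr (_ * _); rewrite !mulgA layer_incl_central.
Qed.

HB.instance Definition _ f :=
  isMultiplicative.Build (N k.+1) (N k.+1) (translate f) (translateM f).

(** As [k >= 1], the layer dies in [N 1]. A translation therefore preserves the argument of the next
    homomorphism, so composition becomes pointwise product. *)
Lemma ab_translate f u : ab (translate f u) = ab u.
Proof. by rewrite /translate gmulfM /= ab_layer_incl mul1g. Qed.

Lemma pr_translate f u : pr (translate f u) = pr u.
Proof. by rewrite /translate gmulfM /= pr_layer_incl mul1g. Qed.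

Lemma translate_comp f g u : translate (f * g) u = translate f (translate g u).
Proof. by rewrite {2}/translate ab_translate mulgA -layer_inclM. Qed.

Lemma translate1 u : translate 1 u = u.
Proof. by rewrite /translate [incl _]gmulf1 mul1g. Qed.

Lemma translate_bij f : bijective (translate f).
Proof.
exists (translate f^-1) => u;
  by rewrite -translate_comp ?mulVg ?mulgV translate1.
Qed.

Definition translation f : aut (N k.+1) :=
  @Aut (N k.+1) (translate f) (translate_bij f).

Lemma translationM : {morph translation : f g / f * g}.
Proof. by move=> f g; apply: aut_ext => u; exact: translate_comp. Qed.

HB.instance Definition _ :=
  isMultiplicative.Build hom (aut (N k.+1)) translation translationM.

Lemma translation_inj : injective translation.
Proof.
move=> f g fg; apply: multiplicative_ext => v.
have [u <-] : exists u, ab u = v by exact: quot_proj_surj.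
have /mulIg fgu : translate f u = translate g u.
  by rewrite -[LHS]/(translation f u) fg.
exact: val_inj fgu.
Qed.

(* [f u / u] lies in the central layer, so it is multiplicative in [u]. *)
Lemma translate_ex (f : {multiplicative N k.+1 -> N k.+1}) :
  (forall u, pr (f u) = pr u) -> exists g, f =1 translate g.
Proof.
move=> prf.
have Lf u : f u / u \in (layer_set b p G k.+1).
  apply/mem_set/trunc_eq1.
  by rewrite gmulfM morV /= prf mulgV.
pose d u : L := Sub (f u / u) (Lf u).
have dM : {morph d : u v / u * v}.
  move=> u v; apply: val_inj; rewrite -[RHS]/(incl _) layer_inclM.
  rewrite /layer_incl !SubK gmulfM invgM -[in RHS]mulgA.
  by rewrite -(layer_central u^-1 (set_mem (Lf v))) !mulgA.
pose d' := HB.pack_for {multiplicative N k.+1 -> L} d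
  (isMultiplicative.Build (N k.+1) L d dM).
have [g gd] : exists g : {multiplicative N 1 -> L}, forall u, g (ab u) = d' u.
  apply: factor_multiplicative; first exact: quot_proj_surj.
  exact: multiplicative_ab.
exists g => u; rewrite /translate /hom_fun gd.
by rewrite /layer_incl SubK mulgVK.
Qed.

Lemma psi_eq1 (c : aut (N k.+1)) :
  psi b p G k c = 1 <-> forall u, pr (c u) = pr u.
Proof.
split=> [c1 u|prc]; first by rewrite -psi_trunc c1.
by apply: aut_ext => v; rewrite -(trunc_liftK v) psi_trunc prc.
Qed.

Lemma translation_range : range translation = psi b p G k @^-1` [set 1].
Proof.
apply/seteqP; split=> [_ [f _ <-]|c /psi_eq1 prc] /=.
  by apply/psi_eq1; exact: pr_translate.
by have [f cf] := translate_ex prc; exists f => //; apply: aut_ext.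
Qed.

(** * Lifting automorphisms *)

Hypothesis freeG : free_of_finite_rank G.

Lemma trunc_mor_lift (c : {multiplicative N k -> N k}) :
  exists f : {multiplicative N k.+1 -> N k.+1}, forall u, pr (f u) = c (pr u).
Proof.
have [g gc] : exists g : {multiplicative G -> N k.+1},
    forall x, pr (g x) = (c \o pr \o coset (modp_nsg b p G k.+2)) x.
  by apply: free_lift => //; exact: quot_proj_surj.
have [f fg] : exists f : {multiplicative N k.+1 -> N k.+1},
    forall x, f (coset (modp_nsg b p G k.+2) x) = g x.
  apply: factor_multiplicative => [|x /coset_eq1 Sx]; first exact: coset_surj.
  (* [g] maps this term into the same term of [N k.+1], which is trivial as the image of that of
     [G]. *)
  suff sub : g @` modp_series b p G k.+2 `<=` [set 1] by apply: sub; exists x.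
  apply: subset_trans (@modp_series_mor _ _ g b p k.+2) _.
  apply: subset_trans (modp_series_surj (k := k.+2)
    (@coset_surj _ (modp_nsg b p G k.+2))) _.
  by move=> _ [y Sy <-]; apply/coset_eq1.
by exists f; elim/quot_ind=> x; rewrite fg gc.
Qed.

Lemma psi_surj c : exists a, psi b p G k a = c.
Proof.
have [f fc] := trunc_mor_lift c; have [g gc] := trunc_mor_lift c^-1.
have [s fgs] : exists s, f \o g =1 translate s.
  by apply: translate_ex => u /=; rewrite fc gc aut_invVK.
have [t gft] : exists t, g \o f =1 translate t.
  by apply: translate_ex => u /=; rewrite gc fc aut_invK.
(* Bijectivity of [g \o f] makes [f] injective; that of [f \o g] gives [f] a right inverse, which is
   then two-sided. *)
have [s' _ sK] := translate_bij s.
have [t' tK _] := translate_bij t.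
have fI : injective f.
  by apply: (can_inj (g := t' \o g)) => u /=; rewrite [g _]gft tK.
have fK : cancel (g \o s') f by move=> u /=; rewrite [f _]fgs sK.
have fB : bijective f by exists (g \o s') => //; exact: inj_can_sym fI.
exists (Aut fB); apply: aut_ext => v.
by rewrite -(trunc_liftK v) psi_trunc fc.
Qed.

End Translations.

Theorem proposition4p4p3 (p : nat) (pP : prime p) (Gamma : groupType)
    (freeG : free_of_finite_rank Gamma) (b : modp_kind) (k : nat)
    (k_ge1 : (1 <= k)%N) :
  exists (abL : commutative (@mul (modp_layer b p Gamma k.+1)))
         (i : {multiplicative hom_group (modp_quot b p Gamma 1) abL ->
                              aut (modp_quot b p Gamma k.+1)}),
    (forall (f : hom_group (modp_quot b p Gamma 1) abL)
            (gamma : modp_quot b p Gamma k.+1),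
        i f gamma =
        layer_incl (hom_fun f (modp_trunc b p Gamma (ltn0Sn k) gamma)) * gamma)
    /\ short_exact i (psi b p Gamma k).
Proof.
exists (@layer_commutative p b Gamma k pP), (translation k_ge1).
split=> //; split.
- exact: translation_inj.
- exact: translation_range.
- exact: psi_surj.
Qed.
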